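(* Let $(\mathcal{N},\circ_\lambda,\ast_\lambda)$ be a Novikov-Poisson conformal superalgebra. Define $$[a_\lambda b]=a\ast_\lambda b-(-1)^{|a||b|}(b\ast_{-\partial-\lambda}a),\qquad\forall\,a,b\in\mathcal{N}.$$ Then $(\mathcal{N},\circ_\lambda,[\cdot_\lambda\cdot])$ is a transposed Poisson conformal superalgebra (TPCSA).
   Context: All vector spaces and linear maps are over $\mathbb{C}$. A $\mathbb{Z}_2$-graded $\mathbb{C}[\partial]$-module is a $\mathbb{C}[\partial]$-module $A=A_{\bar0}\oplus A_{\bar1}$ with $\partial A_i\subseteq A_i$; $|a|$ denotes the parity of a homogeneous element $a$. Whenever $|a|$ occurs, $a$ is assumed homogeneous, and the formula is extended by linearity. $A[\lambda]$ denotes polynomials in $\lambda$ with coefficients in $A$. A conformal superalgebra $(A,\circ_\lambda)$ is a $\mathbb{Z}_2$-graded $\mathbb{C}[\partial]$-module $A$ with a $\mathbb{C}$-bilinear map $A\otimes A\to A[\lambda]$, $a\otimes b\mapsto a\circ_\lambda b$, with $A_i\circ_\lambda A_j\subseteq A_{i+j}[\lambda]$, satisfying sesquilinearity: $(\partial a)\circ_\lambda b=-\lambda\, a\circ_\lambda b$, $a\circ_\lambda(\partial b)=(\partial+\lambda)(a\circ_\lambda b)$. Substitution convention: if $a\circ_\lambda b=\sum_n\lambda^n c_n$, then $a\circ_{-\partial-\lambda}b=\sum_n(-\partial-\lambda)^nc_n$ with $\partial$ acting on the coefficients $c_n$, and similarly for other products and brackets; in nested expressions, a $\partial$ in a subscript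 acts on the result of the product of which it is the subscript. It is commutative if $a\circ_\lambda b=(-1)^{|a||b|}b\circ_{-\partial-\lambda}a$, and associative if $a\circ_\lambda(b\circ_\mu c)=(a\circ_\lambda b)\circ_{\lambda+\mu}c$, for all $a,b,c$. A left-symmetric conformal superalgebra $(A,\ast_\lambda)$ is a conformal superalgebra with $(a\ast_\lambda b)\ast_{\lambda+\mu}c-a\ast_\lambda(b\ast_\mu c)=(-1)^{|a||b|}\big((b\ast_\mu a)\ast_{\lambda+\mu}c-b\ast_\mu(a\ast_\lambda c)\big)$. A Novikov conformal superalgebra is a left-symmetric conformal superalgebra with $(a\ast_\lambda b)\ast_{\lambda+\mu}c=(-1)^{|b||c|}(a\ast_\lambda c)\ast_{-\mu-\partial}b$. A Novikov-Poisson conformal superalgebra $(\mathcal{N},\circ_\lambda,\ast_\lambda)$ is a $\mathbb{Z}_2$-graded $\mathbb{C}[\partial]$-module such that $(\mathcal{N},\circ_\lambda)$ is a commutative associative conformal superalgebra, $(\mathcal{N},\ast_\lambda)$ is a Novikov conformal superalgebra, and for all $a,b,c$: $(a\circ_\lambda b)\ast_{\lambda+\mu}c=a\circ_\lambda(b\ast_\mu c)$ and $(a\ast_\lambda b)\circ_{\lambda+\mu}c-a\ast_\lambda(b\circ_\mu c)=(-1)^{|a||b|}\big((b\ast_\mu a)\circ_{\lambda+\mu}c-b\ast_\mu(a\circ_\lambda c)\big)$. A Lie conformal superalgebra $(A,[\cdot_\lambda\cdot])$ is a $\mathbb{Z}_2$-graded $\mathbb{C}[\partial]$-module with a $\mathbb{C}$-bilinear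 map $a\otimes b\mapsto[a_\lambda b]\in A[\lambda]$, $[{A_i}_\lambda A_j]\subseteq A_{i+j}[\lambda]$, such that $[(\partial a)_\lambda b]=-\lambda[a_\lambda b]$, $[a_\lambda(\partial b)]=(\partial+\lambda)[a_\lambda b]$, $[a_\lambda b]=-(-1)^{|a||b|}[b_{-\lambda-\partial}a]$, and $[a_\lambda[b_\mu c]]=[[a_\lambda b]_{\lambda+\mu}c]+(-1)^{|a||b|}[b_\mu[a_\lambda c]]$. A transposed Poisson conformal superalgebra (TPCSA) is a $\mathbb{Z}_2$-graded $\mathbb{C}[\partial]$-module $\mathcal{L}$ with $\circ_\lambda$ and $[\cdot_\lambda\cdot]$ such that $(\mathcal{L},\circ_\lambda)$ is a commutative associative conformal superalgebra, $(\mathcal{L},[\cdot_\lambda\cdot])$ is a Lie conformal superalgebra, and $2(a\circ_\lambda[b_\mu c])=[(a\circ_\lambda b)_{\lambda+\mu}c]+(-1)^{|a||b|}[b_\mu(a\circ_\lambda c)]$ for all $a,b,c\in\mathcal{L}$. *)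

(* Defs.v *)
From HB Require Import structures.
From mathcomp Require Import all_boot all_algebra.
From mathcomp Require Import boolp classical_sets functions cardinality fsbigop.
From mathcomp Require Import reals complex.

Set Implicit Arguments.
Unset Strict Implicit.
Unset Printing Implicit Defensive.

Import GRing.Theory.
Local Open Scope ring_scope.

Section FiniteSupport.
Context (K : fieldType) (M : lmodType K).

Definition finitely_supported : {pred nat -> M} :=
  fun f => `[< exists N, forall n, (N <= n)%N -> f n = 0 >].

Lemma finitely_supportedP : submod_closed finitely_supported.
Proof.
split=> [|a f g /asboolP[m fm] /asboolP[n gn]]; apply/asboolP.
  by exists 0%N.
exists (maxn m n) => k; rewrite geq_max => /andP[mk nk].
by rewrite /= (_ : (a *: f + g) k = a *: f k + g k) // fm // gn // scaler0 addr0.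
Qed.

HB.instance Definition _ := GRing.isSubmodClosed.Build K (nat -> M)
  finitely_supported finitely_supportedP.

End FiniteSupport.

(* [polymod M] is M[X]; its elements coerce to their coefficient functions. *)
Record polymod (K : fieldType) (M : lmodType K) := Polymod {
  coefs :> nat -> M;
  coefsP : finitely_supported coefs
}.

HB.instance Definition _ (K : fieldType) (M : lmodType K) :=
  [isSub for @coefs K M].
HB.instance Definition _ (K : fieldType) (M : lmodType K) :=
  [Choice of polymod M by <:].
HB.instance Definition _ (K : fieldType) (M : lmodType K) :=
  [SubChoice_isSubLmodule of polymod M by <:].

Lemma coefs_linear (K : fieldType) (M : lmodType K) (k : K) (p q : polymod M)
    (n : nat) : (k *: p + q) n = k *: p n + q n.
Proof. by []. Qed.

Lemma polymod_eq (K : fieldType) (M : lmodType K) (p q : polymod M) :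
  p =1 q -> p = q.
Proof. by move=> /funext pq; apply/val_inj. Qed.

Section PolymodOperations.
Context (K : fieldType) (M N : lmodType K).

Lemma polyconst_subproof (a : M) :
  finitely_supported (fun n => if n is 0%N then a else 0).
Proof. by apply/asboolP; exists 1%N => -[]. Qed.

Definition polyconst (a : M) : polymod M := Polymod (polyconst_subproof a).

Lemma polymulX_subproof (p : polymod M) :
  finitely_supported (fun n => if n is m.+1 then p m else 0).
Proof.
have /asboolP[m pm] := coefsP p.
by apply/asboolP; exists m.+1 => -[//|n]; exact: pm.
Qed.

Definition polymulX (p : polymod M) : polymod M :=
  Polymod (polymulX_subproof p).

Lemma polymap_subproof (f : {linear M -> N}) (p : polymod M) :
  finitely_supported (fun n => f (p n)).
Proof.
have /asboolP[m pm] := coefsP p.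
by apply/asboolP; exists m => n mn; rewrite pm // linear0.
Qed.

Definition polymap (f : {linear M -> N}) (p : polymod M) : polymod N :=
  Polymod (polymap_subproof f p).

Lemma polyconst_is_linear : linear polyconst.
Proof.
move=> k a b; apply: polymod_eq => -[|n]; rewrite coefs_linear //=.
by rewrite scaler0 addr0.
Qed.

HB.instance Definition _ :=
  GRing.isLinear.Build K M (polymod M) _ polyconst polyconst_is_linear.

Lemma polymulX_is_linear : linear polymulX.
Proof.
move=> k p q; apply: polymod_eq => -[|n]; rewrite coefs_linear //=.
by rewrite scaler0 addr0.
Qed.

HB.instance Definition _ :=
  GRing.isLinear.Build K (polymod M) (polymod M) _ polymulX polymulX_is_linear.

Lemma polymap_is_linear (f : {linear M -> N}) : linear (polymap f).
Proof. by move=> k p q; apply: polymod_eq => n; exact: linearP. Qed.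

HB.instance Definition _ (f : {linear M -> N}) :=
  GRing.isLinear.Build K (polymod M) (polymod N) _ (polymap f)
    (polymap_is_linear f).

End PolymodOperations.

(* [psubst i S p] is \sum_n S^n (i p_n): the polynomial p evaluated at the
   operator S, its coefficients being carried into V by i. The sum has only
   finitely many nonzero terms as soon as i and S map 0 to 0. *)
Definition psubst (K : fieldType) (M V : lmodType K) (i : M -> V) (S : V -> V)
    (p : polymod M) : V :=
  \sum_(n \in [set: nat]) iter n S (i (p n)).

(* A Z_2-graded K[d]-module: a vector space with an endomorphism d, and two
   d-stable subspaces [hom_part false] (even) and [hom_part true] (odd) of which
   it is the direct sum. Parities are booleans, added with [(+)]. *)
Record gradedDModule (K : fieldType) := GradedDModule {
  carrier :> lmodType K;
  partial : {linear carrier -> carrier};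
  hom_part : bool -> submodClosed carrier;
  hom_decomp : forall a : carrier, exists u : carrier * carrier,
    [&& u.1 \in hom_part false, u.2 \in hom_part true & a == u.1 + u.2];
  hom_disjoint : forall a : carrier,
    a \in hom_part false -> a \in hom_part true -> a = 0;
  hom_partial : forall (i : bool) (a : carrier),
    a \in hom_part i -> partial a \in hom_part i
}.

Definition hom_comp (K : fieldType) (A : gradedDModule K) (i : bool) (a : A) : A :=
  let u := xchoose (hom_decomp a) in if i then u.2 else u.1.

Section LambdaProducts.
Context (K : fieldType) (A : gradedDModule K).

Definition ksign (i j : bool) : K := (-1) ^+ (i && j).

Definition lambda_product := A -> A -> polymod A.

Definition lam1 : polymod A -> polymod A := @polymulX K A.
Definition partial1 : polymod A -> polymod A := polymap (@partial K A).
(* Substitution of - partial - lambda for lambda; lam1 is multiplication by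
   lambda on A[lambda]. *)
Definition flip1 : polymod A -> polymod A :=
  psubst (@polyconst K A) (fun p => - partial1 p - lam1 p).

(* A[lambda, mu] is encoded as A[lambda][mu]: the inner variable is lambda. *)
Definition poly2 : lmodType K := polymod (polymod A).

Definition const2 (a : A) : poly2 := polyconst (polyconst a).
Definition lam : poly2 -> poly2 := polymap (@polymulX K A).
Definition mu : poly2 -> poly2 := @polymulX K (polymod A).
Definition partial2 : poly2 -> poly2 := polymap (polymap (@partial K A)).

(* the K[lambda, mu]-linear extension of f *)
Definition extend2 (f : A -> poly2) : poly2 -> poly2 :=
  psubst (psubst f lam) mu.

(* [lprod op S u v] is u op_S v: the K[lambda, mu]-bilinear extension of
   (a, b) |-> a op_S b. When S involves partial, it thus acts on the result
   of the product. *)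
Definition lprod (op : lambda_product) (S : poly2 -> poly2) (u v : poly2) :
    poly2 :=
  extend2 (fun a => extend2 (fun b => psubst const2 S (op a b)) v) u.

Definition lam_add_mu (u : poly2) : poly2 := lam u + mu u.
Definition opp_mu_partial (u : poly2) : poly2 := - mu u - partial2 u.

Local Notation "a '%:P2'" := (const2 a) (at level 2, format "a %:P2").

Record conformal_superalgebra (op : lambda_product) : Prop :=
  ConformalSuperalgebra {
  conf_linear_l : forall b : A, linear (op ^~ b);
  conf_linear_r : forall a : A, linear (op a);
  conf_graded : forall (i j : bool) (a b : A),
    a \in hom_part A i -> b \in hom_part A j ->
    forall n : nat, op a b n \in hom_part A (i (+) j);
  conf_sesqui_l : forall a b : A, op (partial A a) b = - lam1 (op a b);
  conf_sesqui_r : forall a b : A,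
    op a (partial A b) = partial1 (op a b) + lam1 (op a b)
}.

Definition commutative_product (op : lambda_product) : Prop :=
  forall (i j : bool) (a b : A), a \in hom_part A i -> b \in hom_part A j ->
    op a b = ksign i j *: flip1 (op b a).

Definition associative_product (op : lambda_product) : Prop :=
  forall a b c : A,
    lprod op lam a%:P2 (lprod op mu b%:P2 c%:P2) =
    lprod op lam_add_mu (lprod op lam a%:P2 b%:P2) c%:P2.

Record comm_assoc_conformal (op : lambda_product) : Prop := CommAssocConformal {
  ca_conformal : conformal_superalgebra op;
  ca_commutative : commutative_product op;
  ca_associative : associative_product op
}.

Record left_symmetric_conformal (op : lambda_product) : Prop :=
  LeftSymmetricConformal {
  ls_conformal : conformal_superalgebra op;
  ls_left_symmetric : forall (i j : bool) (a b c : A),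
    a \in hom_part A i -> b \in hom_part A j ->
    lprod op lam_add_mu (lprod op lam a%:P2 b%:P2) c%:P2
      - lprod op lam a%:P2 (lprod op mu b%:P2 c%:P2) =
    ksign i j *:
      (lprod op lam_add_mu (lprod op mu b%:P2 a%:P2) c%:P2
         - lprod op mu b%:P2 (lprod op lam a%:P2 c%:P2))
}.

Record Novikov_conformal (op : lambda_product) : Prop := NovikovConformal {
  nov_left_symmetric : left_symmetric_conformal op;
  nov_right : forall (j k : bool) (a b c : A),
    b \in hom_part A j -> c \in hom_part A k ->
    lprod op lam_add_mu (lprod op lam a%:P2 b%:P2) c%:P2 =
    ksign j k *:
      lprod op opp_mu_partial (lprod op lam a%:P2 c%:P2) b%:P2
}.

Record Novikov_Poisson_conformal (circ ast : lambda_product) : Prop :=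
  NovikovPoissonConformal {
  np_circ : comm_assoc_conformal circ;
  np_ast : Novikov_conformal ast;
  np_circ_ast : forall a b c : A,
    lprod ast lam_add_mu (lprod circ lam a%:P2 b%:P2) c%:P2 =
    lprod circ lam a%:P2 (lprod ast mu b%:P2 c%:P2);
  np_ast_circ : forall (i j : bool) (a b c : A),
    a \in hom_part A i -> b \in hom_part A j ->
    lprod circ lam_add_mu (lprod ast lam a%:P2 b%:P2) c%:P2
      - lprod ast lam a%:P2 (lprod circ mu b%:P2 c%:P2) =
    ksign i j *:
      (lprod circ lam_add_mu (lprod ast mu b%:P2 a%:P2) c%:P2
         - lprod ast mu b%:P2 (lprod circ lam a%:P2 c%:P2))
}.

Record Lie_conformal (br : lambda_product) : Prop := LieConformal {
  lie_conformal : conformal_superalgebra br;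
  lie_skew : forall (i j : bool) (a b : A),
    a \in hom_part A i -> b \in hom_part A j ->
    br a b = - (ksign i j *: flip1 (br b a));
  lie_Jacobi : forall (i j : bool) (a b c : A),
    a \in hom_part A i -> b \in hom_part A j ->
    lprod br lam a%:P2 (lprod br mu b%:P2 c%:P2) =
    lprod br lam_add_mu (lprod br lam a%:P2 b%:P2) c%:P2
      + ksign i j *: lprod br mu b%:P2 (lprod br lam a%:P2 c%:P2)
}.

Record TPCSA (circ br : lambda_product) : Prop := MkTPCSA {
  tp_circ : comm_assoc_conformal circ;
  tp_bracket : Lie_conformal br;
  tp_compat : forall (i j : bool) (a b c : A),
    a \in hom_part A i -> b \in hom_part A j ->
    2%:R *: lprod circ lam a%:P2 (lprod br mu b%:P2 c%:P2) =
    lprod br lam_add_mu (lprod circ lam a%:P2 b%:P2) c%:P2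
      + ksign i j *: lprod br mu b%:P2 (lprod circ lam a%:P2 c%:P2)
}.

(* The sign is only defined on homogeneous elements, so the formula
   a ast_lambda b - (-1)^(|a||b|) b ast_(-partial-lambda) a is applied to the
   homogeneous components and summed. *)
Definition super_commutator (ast : lambda_product) : lambda_product :=
  fun a b => \sum_(i : bool) \sum_(j : bool)
    (ast (hom_comp i a) (hom_comp j b)
       - ksign i j *: flip1 (ast (hom_comp j b) (hom_comp i a))).

End LambdaProducts.

(* Main.v *)
(* Give the three arguments of a triple product the spectral parameters P, Q, N
   with D + P + Q + N = 0, where D is the action of the derivation on the
   result. The substitution -partial-lambda then just permutes the pairs
   (argument, parameter), so the commutator turns every bracketed triple product
   into a signed sum of right- and left-nested products over the permutations
   of (a, P), (b, Q), (c, N), and an axiom stated for the parameters lambda, mu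
   holds for any two of the three. After normalizing the signs, the Jacobi
   identity and the transposed Leibniz rule follow from left-symmetry and the
   two compatibility axioms exactly as for ordinary Novikov-Poisson algebras. *)
From HB Require Import structures.
Require Import Defs.
From mathcomp Require Import all_boot all_algebra reals complex.
From mathcomp Require Import boolp classical_sets fsbigop.

Set Implicit Arguments.
Unset Strict Implicit.
Unset Printing Implicit Defensive.

Import GRing.Theory.
Local Open Scope ring_scope.

(** * Linearity as a proposition *)

Section LinearProp.
Context (K : fieldType) (U V W : lmodType K).
Implicit Types (f g : U -> V) (h : V -> W).

(** Products and substituted operators are only known to be linear through hypotheses; packing them
    makes the library lemmas on [{linear U -> V}] available. *)
Lemma linear_prop_packed f : linear f -> exists f' : {linear U -> V}, f' =1 f.
Proof.
move=> lf; pose m := GRing.isLinear.Build K U V _ f lf.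
by exists (HB.pack_for {linear U -> V} f m).
Qed.

Lemma linear_prop0 f : linear f -> f 0 = 0.
Proof. by move=> /linear_prop_packed[f' <-]; rewrite linear0. Qed.

Lemma linear_propN f u : linear f -> f (- u) = - f u.
Proof. by move=> /linear_prop_packed[f' ff]; rewrite -!ff linearN. Qed.

Lemma linear_propD f u v : linear f -> f (u + v) = f u + f v.
Proof. by move=> /linear_prop_packed[f' ff]; rewrite -!ff linearD. Qed.

Lemma linear_propB f u v : linear f -> f (u - v) = f u - f v.
Proof. by move=> /linear_prop_packed[f' ff]; rewrite -!ff linearB. Qed.

Lemma linear_propZ f k u : linear f -> f (k *: u) = k *: f u.
Proof. by move=> /linear_prop_packed[f' ff]; rewrite -!ff linearZ. Qed.

Lemma linear_prop_comp f h : linear f -> linear h -> linear (fun u => h (f u)).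
Proof. by move=> lf lh k u v; rewrite lf lh. Qed.

Lemma linear_prop_add f g : linear f -> linear g -> linear (fun u => f u + g u).
Proof. by move=> lf lg k u v; rewrite lf lg scalerDr addrACA. Qed.

Lemma linear_prop_opp f : linear f -> linear (fun u => - f u).
Proof. by move=> lf k u v; rewrite lf opprD scalerN. Qed.

Lemma linear_prop_scale f k : linear f -> linear (fun u => k *: f u).
Proof. by move=> lf l u v; rewrite lf scalerDr !scalerA mulrC. Qed.

End LinearProp.

(** * Evaluation of polynomials at operators *)

Section Substitution.
Context (K : fieldType) (M V : lmodType K).
Implicit Types (i : M -> V) (S : V -> V) (p q : polymod M).

Lemma eq_psubst i j S p : (forall n, i (p n) = j (p n)) ->
  psubst i S p = psubst j S p.
Proof. by move=> ij; apply: eq_fsbigr => n _; rewrite ij. Qed.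

Lemma psubst_sum i S p N : i 0 = 0 -> S 0 = 0 ->
    (forall n, (N <= n)%N -> p n = 0) ->
  psubst i S p = \sum_(n < N) iter n S (i (p n)).
Proof.
move=> i0 S0 pN; rewrite (fsbig_ord _ _ (fun n => iter n S (i (p n)))).
symmetry; apply: fsbig_widen => // n [_ /negP]; rewrite -leqNgt => /pN pn0 /=.
by rewrite pn0 i0; elim: n {pn0} => //= n ->.
Qed.

Lemma psubst_const i S a : i 0 = 0 -> S 0 = 0 -> psubst i S (polyconst a) = i a.
Proof. by move=> i0 S0; rewrite (psubst_sum (N := 1)) ?big_ord1// => -[]. Qed.

Lemma polymod_bound p : exists N, forall n, (N <= n)%N -> p n = 0.
Proof. exact/asboolP/(coefsP p). Qed.

Lemma linear_iter S n : linear S -> linear (iter n S).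
Proof. by move=> lS; elim: n => // n IH k u v; rewrite !iterS IH lS. Qed.

(** The coefficients are shifted by one: the new constant term contributes [i 0 = 0], and every
    other term gains one factor [S]. *)
Lemma psubst_mulX i S p : linear i -> linear S ->
  psubst i S (polymulX p) = S (psubst i S p).
Proof.
move=> li lS; have [N pN] := polymod_bound p.
have [i0 S0] := (linear_prop0 li, linear_prop0 lS).
rewrite (psubst_sum (N := N.+1)) // => [|[//|n]]; last exact: pN.
rewrite (psubst_sum (N := N)) // big_ord_recl /= i0 add0r.
have [S' SS] := linear_prop_packed lS.
by rewrite -[RHS]SS linear_sum; apply: eq_bigr => n _; rewrite SS.
Qed.

Lemma psubst_linear i S : linear i -> linear S -> linear (psubst i S).
Proof.
move=> li lS k p q.
have [N pN] := polymod_bound p; have [N' qN] := polymod_bound q.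
have [i0 S0] := (linear_prop0 li, linear_prop0 lS).
have pN' n : (maxn N N' <= n)%N -> p n = 0 by rewrite geq_max => /andP[/pN].
have qN' n : (maxn N N' <= n)%N -> q n = 0 by rewrite geq_max => /andP[_ /qN].
have sumE := psubst_sum i0 S0; rewrite (sumE _ _ pN') (sumE _ _ qN').
rewrite (sumE _ (maxn N N')) => [|n Nn]; last first.
  by rewrite coefs_linear pN' // qN' // scaler0 addr0.
rewrite scaler_sumr -big_split /=; apply: eq_bigr => n _.
by rewrite -(linear_iter n lS) -li.
Qed.

(** Induction on a bound for the support: [p] is its constant term plus X times the shifted
    polynomial. *)
Lemma polymod_ind_linear (P : polymod M -> Prop) :
  (forall a, P (polyconst a)) -> (forall p, P p -> P (polymulX p)) ->
  (forall p q, P p -> P q -> P (p + q)) -> forall p, P p.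
Proof.
move=> Pc PX PD p; have [N] := polymod_bound p.
elim: N p => [|N IH] p pN.
  (* With bound 0 the polynomial vanishes, and zero is covered by the case of constants. *)
  rewrite (_ : p = polyconst 0) //; apply: polymod_eq => -[|n]; exact: pN.
have sp : finitely_supported (fun n => p n.+1).
  by apply/asboolP; exists N => n Nn; apply: pN.
rewrite (_ : p = polyconst (p 0%N) + polymulX (Polymod sp)).
  by apply/PD => //; apply/PX/IH => n Nn; apply: pN.
apply: polymod_eq => n.
rewrite -[polyconst _]scale1r coefs_linear scale1r.
by case: n => [|n] /=; rewrite ?addr0 ?add0r.
Qed.

(* The universal property of M[X]: psubst i S is the only linear map extending
   i and turning multiplication by X into S. *)
Lemma psubst_unique i S (h : polymod M -> V) p : linear i -> linear S ->
    linear h -> (forall a, h (polyconst a) = i a) ->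
    (forall q, h (polymulX q) = S (h q)) ->
  h p = psubst i S p.
Proof.
move=> li lS lh hc hX; have lp := psubst_linear li lS.
elim/polymod_ind_linear: p => [a|p hp|p q hp hq].
- by rewrite hc psubst_const //; apply: linear_prop0.
- by rewrite hX hp psubst_mulX.
- by rewrite (linear_propD _ _ lh) hp hq -linear_propD.
Qed.

Lemma psubstD i j S p : linear i -> linear j -> linear S ->
  psubst (fun a => i a + j a) S p = psubst i S p + psubst j S p.
Proof.
move=> li lj lS; symmetry.
apply: (psubst_unique (h := fun p => psubst i S p + psubst j S p)) => //.
- exact: linear_prop_add.
- by apply: linear_prop_add; apply: psubst_linear.
- by move=> a; rewrite !psubst_const ?linear_prop0.
- by move=> q; rewrite !psubst_mulX // -linear_propD.
Qed.

Lemma psubstZ i k S p : linear i -> linear S ->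
  psubst (fun a => k *: i a) S p = k *: psubst i S p.
Proof.
move=> li lS; symmetry.
apply: (psubst_unique (h := fun p => k *: psubst i S p)) => //.
- exact: linear_prop_scale.
- by apply: linear_prop_scale; apply: psubst_linear.
- by move=> a; rewrite !psubst_const ?linear_prop0.
- by move=> q; rewrite !psubst_mulX // -linear_propZ.
Qed.

End Substitution.

(** [h] passes through the finite sum and turns each power of [S] into the same power of [S']. This
    is the tool for moving operators and substitutions across products. *)
Lemma psubst_intertwine (K : fieldType) (M V W : lmodType K) (i : M -> V)
    (S : V -> V) (h : V -> W) (S' : W -> W) (p : polymod M) :
    linear i -> linear S -> linear h -> linear S' ->
    (forall v, h (S v) = S' (h v)) ->
  h (psubst i S p) = psubst (fun a => h (i a)) S' p.
Proof.
move=> li lS lh lS' hS; have [N pN] := polymod_bound p.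
have [[i0 S0] h0] := (linear_prop0 li, linear_prop0 lS, linear_prop0 lh).
rewrite (psubst_sum i0 S0 pN) (psubst_sum _ (linear_prop0 lS') pN) ?i0 //.
have [h' hh] := linear_prop_packed lh.
rewrite -[LHS]hh linear_sum; apply: eq_bigr => n _; rewrite {}hh.
by move: (i (p n)) => v; elim: (nat_of_ord n) => //= m IH; rewrite hS IH.
Qed.

(** * The substitution -partial-lambda *)

Section Flip.
Context (K : fieldType) (A : gradedDModule K).
Implicit Types (p q : polymod A).

Lemma lam1_linear : linear (@lam1 K A). Proof. exact: linearP. Qed.
Lemma partial1_linear : linear (@partial1 K A). Proof. exact: linearP. Qed.
Lemma polyconst_linear : linear (@polyconst K A). Proof. exact: linearP. Qed.

Lemma opp_partial_lam_linear : linear (fun p => - partial1 p - lam1 p).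
Proof.
apply: linear_prop_add; apply: linear_prop_opp.
  exact: partial1_linear.
exact: lam1_linear.
Qed.

Lemma flip1_linear : linear (@flip1 K A).
Proof.
apply: psubst_linear; [exact: polyconst_linear|exact: opp_partial_lam_linear].
Qed.

Lemma psubst_partial1 (V : lmodType K) (i : A -> V) (S E : V -> V) p :
    linear i -> linear S -> linear E ->
    (forall a, i (partial A a) = E (i a)) -> (forall v, E (S v) = S (E v)) ->
  psubst i S (partial1 p) = E (psubst i S p).
Proof.
move=> li lS lE iE ES; rewrite (psubst_intertwine _ li lS lE lS ES).
by apply: eq_fsbigr => n _ /=; rewrite iE.
Qed.

(** Evaluation at [S] turns lambda into [S] and partial into [E], hence -partial-lambda into
    [- E - S]. *)
Lemma psubst_flip1 (V : lmodType K) (i : A -> V) (S E : V -> V) p :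
    linear i -> linear S -> linear E ->
    (forall a, i (partial A a) = E (i a)) -> (forall v, E (S v) = S (E v)) ->
  psubst i S (flip1 p) = psubst i (fun v => - E v - S v) p.
Proof.
move=> li lS lE iE ES; have lpsi := psubst_linear li lS.
rewrite /flip1 (psubst_intertwine (S' := fun v => - E v - S v) _ _ _ lpsi).
- by apply: eq_psubst => n; rewrite psubst_const ?linear_prop0.
- exact: polyconst_linear.
- exact: opp_partial_lam_linear.
- by apply: linear_prop_add; apply: linear_prop_opp.
- move=> q; rewrite (linear_propD _ _ lpsi) !(linear_propN _ lpsi).
  by rewrite (psubst_partial1 _ li lS lE iE ES) psubst_mulX.
Qed.

Lemma partial1_polyconst a : partial1 (polyconst a) = polyconst (partial A a).
Proof. by apply: polymod_eq => -[|n] //=; rewrite linear0. Qed.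

Lemma partial1_lam1 p : partial1 (lam1 p) = lam1 (partial1 p).
Proof. by apply: polymod_eq => -[|n] //=; rewrite linear0. Qed.

Lemma psubst_polyconst_lam1 p : psubst (@polyconst K A) (@lam1 K A) p = p.
Proof.
symmetry; apply: (psubst_unique (h := id)) => //.
  exact: polyconst_linear.
exact: lam1_linear.
Qed.

Lemma flip1_lam1 p : flip1 (lam1 p) = - partial1 (flip1 p) - lam1 (flip1 p).
Proof.
apply: psubst_mulX; [exact: polyconst_linear|exact: opp_partial_lam_linear].
Qed.

Lemma flip1_partial1 p : flip1 (partial1 p) = partial1 (flip1 p).
Proof.
apply: psubst_partial1 => [||||q].
- exact: polyconst_linear.
- exact: opp_partial_lam_linear.
- exact: partial1_linear.
- by move=> a; rewrite partial1_polyconst.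
- have lP := partial1_linear.
  by rewrite (linear_propB _ _ lP) (linear_propN _ lP) partial1_lam1.
Qed.

(** An instance of [psubst_flip1], since -partial-(-partial-lambda) = lambda. *)
Lemma flip1K p : flip1 (flip1 p) = p.
Proof.
rewrite {1}/flip1 (psubst_flip1 (E := @partial1 K A)) => [|||||q].
- rewrite (_ : (fun v => _) = @lam1 K A) ?psubst_polyconst_lam1 //.
  by apply/funext => v; rewrite opprB opprK addrC addrK.
- exact: polyconst_linear.
- exact: opp_partial_lam_linear.
- exact: partial1_linear.
- by move=> a; rewrite partial1_polyconst.
- have lP := partial1_linear.
  by rewrite (linear_propB _ _ lP) (linear_propN _ lP) partial1_lam1.
Qed.

Lemma flip1_hom (i : bool) p : (forall n, p n \in hom_part A i) ->
  forall n, flip1 p n \in hom_part A i.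
Proof.
move=> hp; have [N pN] := polymod_bound p.
rewrite /flip1 (psubst_sum _ _ pN); first last.
- exact: (linear_prop0 opp_partial_lam_linear).
- exact: (linear_prop0 polyconst_linear).
pose H (q : polymod A) := forall n, q n \in hom_part A i.
apply: (big_ind H) => [n|q r hq hr n|m _].
- exact: rpred0.
- exact: (rpredD (hq n) (hr n)).
- move: (p m) (hp m) => a ha; elim: (nat_of_ord m) => [|k IH] n.
    by case: n => [|n]; [exact: ha|exact: rpred0].
  rewrite iterS; move: (iter k _ _) IH => q hq.
  change (- partial A (q n) - lam1 q n \in hom_part A i).
  rewrite -!scaleN1r; apply: rpredD; apply: rpredZ; first exact: hom_partial.
  by case: n => [|n]; [exact: rpred0|exact: hq].
Qed.

End Flip.

(** * Triple products *)

Section TripleProducts.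
Context (K : fieldType) (A : gradedDModule K).
Implicit Types (P Q S : poly2 A -> poly2 A) (a b c : A) (op br : lambda_product A).

Local Notation C := (@const2 K A).
Local Notation L := (@lam K A).
Local Notation M := (@mu K A).
Local Notation D := (@partial2 K A).

Lemma lam_linear : linear L. Proof. exact: linearP. Qed.
Lemma mu_linear : linear M. Proof. exact: linearP. Qed.
Lemma partial2_linear : linear D. Proof. exact: linearP. Qed.
Lemma const2_linear : linear C.
Proof. by move=> k a b; rewrite /const2 !linearP. Qed.

Lemma lam_mu u : L (M u) = M (L u).
Proof. by apply: polymod_eq => -[|n] //=; rewrite linear0. Qed.

Lemma partial2_mu u : D (M u) = M (D u).
Proof. by apply: polymod_eq => -[|n] //=; rewrite linear0. Qed.

Lemma partial2_lam u : D (L u) = L (D u).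
Proof. by apply: polymod_eq => n /=; apply: partial1_lam1. Qed.

Lemma partial2_const2 a : D (C a) = C (partial A a).
Proof.
apply: polymod_eq => -[|n] /=; first exact: partial1_polyconst.
by rewrite linear0.
Qed.

(** The conditions under which two operators can replace lambda and mu. They leave room for
    operators that involve partial, such as -partial-lambda-mu. *)
Record compatible P Q : Prop := Compatible {
  compatible_l : linear P;
  compatible_r : linear Q;
  compatible_comm : forall u, P (Q u) = Q (P u);
  compatible_Dl : forall u, D (P u) = P (D u);
  compatible_Dr : forall u, D (Q u) = Q (D u)
}.

(* The parameter of the remaining argument of a triple product whose other two
   arguments have parameters P and Q. *)
Definition third P Q : poly2 A -> poly2 A := fun u => - D u - (P u + Q u).
Definition addop P Q : poly2 A -> poly2 A := fun u => P u + Q u.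

Lemma compatible_lam_mu : compatible L M.
Proof.
split; [exact: lam_linear|exact: mu_linear|exact: lam_mu|..].
  exact: partial2_lam.
exact: partial2_mu.
Qed.

Lemma compatibleC P Q : compatible P Q -> compatible Q P.
Proof. by case=> lP lQ PQ DP DQ; split. Qed.

Lemma addop_linear P Q : compatible P Q -> linear (addop P Q).
Proof. by case=> lP lQ _ _ _; apply: linear_prop_add. Qed.

(** The new pair starts with [Q], so that iterating the lemma cycles through the three parameters;
    [thirdK] closes the cycle. *)
Lemma compatible_third P Q : compatible P Q -> compatible Q (third P Q).
Proof.
case=> lP lQ PQ DP DQ; have lD := partial2_linear; split=> // [|u|u].
- apply: linear_prop_add; apply: linear_prop_opp => //.
  exact: linear_prop_add.
- by rewrite (linear_propB _ _ lQ) (linear_propN _ lQ) (linear_propD _ _ lQ)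
    /third DQ PQ.
- by rewrite (linear_propB _ _ lD) (linear_propN _ lD) (linear_propD _ _ lD)
    /third DP DQ.
Qed.

Lemma addopC P Q : addop P Q = addop Q P.
Proof. by apply/funext => u; apply: addrC. Qed.

Lemma thirdC P Q : third P Q = third Q P.
Proof. by apply/funext => u; rewrite /third (addrC (P u)). Qed.

Lemma thirdK P Q : third Q (third P Q) = P.
Proof.
apply/funext => u; rewrite /third.
rewrite (addrC (P u)) (opprD (Q u) (P u)) addrCA (addrA (Q u)) subrr add0r.
by rewrite opprD !opprK addrA addNr add0r.
Qed.

(* a op1_P (b op2_Q c), while [ltriple] is (a op1_P b) op2_(P+Q) c; P and Q may
   involve partial2, which in both cases acts on the value of the whole triple
   product. *)
Definition rtriple op1 op2 P Q a b c : poly2 A :=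
  psubst (fun x => psubst C P (op1 a x)) Q (op2 b c).

Definition ltriple op1 op2 P Q a b c : poly2 A :=
  psubst (fun x => psubst C (addop P Q) (op2 x c)) P (op1 a b).

Lemma prodl_linear op S a : conformal_superalgebra op -> linear S ->
  linear (fun x => psubst C S (op a x)).
Proof.
move=> cop lS; apply: linear_prop_comp (psubst_linear const2_linear lS).
exact: conf_linear_r.
Qed.

Lemma prodr_linear op S c : conformal_superalgebra op -> linear S ->
  linear (fun x => psubst C S (op x c)).
Proof.
move=> cop lS.
apply: (linear_prop_comp (f := op ^~ c)) (psubst_linear const2_linear lS).
exact: conf_linear_l.
Qed.

(** Lambda is the inner variable, so it has to cross the outer evaluation at mu, which it does
    because the two multiplications commute. *)
Lemma extend2_lam (f : A -> poly2 A) v : linear f ->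
  extend2 f (L v) = L (extend2 f v).
Proof.
move=> lf; have lS := psubst_linear lf lam_linear.
rewrite /extend2 [RHS](psubst_intertwine _ lS mu_linear lam_linear mu_linear) //.
  by apply: eq_fsbigr => n _ /=; rewrite psubst_mulX //; exact: lam_linear.
exact: lam_mu.
Qed.

Lemma extend2_linear (f : A -> poly2 A) : linear f -> linear (extend2 f).
Proof.
move=> lf; apply: psubst_linear mu_linear.
exact: psubst_linear lam_linear.
Qed.

Lemma extend2_mu (f : A -> poly2 A) v : linear f ->
  extend2 f (M v) = M (extend2 f v).
Proof.
move=> lf; have lS := psubst_linear lf lam_linear.
exact: psubst_mulX mu_linear.
Qed.

Lemma extend2_const2 (f : A -> poly2 A) a : linear f -> extend2 f (C a) = f a.
Proof.
move=> lf; have lS := psubst_linear lf lam_linear.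
rewrite /extend2 /const2 psubst_const; first last.
- exact: linear_prop0 mu_linear.
- exact: linear_prop0 lS.
by rewrite psubst_const //; [exact: linear_prop0|exact: linear_prop0 lam_linear].
Qed.

(** Needed before the outer [extend2] of [lprod] can be evaluated. The left factor sits inside two
    nested evaluations, so additivity and scaling are pulled out of each level in turn. *)
Lemma extend2_linear_fun op S v : conformal_superalgebra op -> linear S ->
  linear (fun a => extend2 (fun b => psubst C S (op a b)) v).
Proof.
move=> cop lS k x y.
have lr z := prodl_linear z cop lS; have ll z := prodr_linear z cop lS.
set fx := fun b => psubst C S (op x b); set fy := fun b => psubst C S (op y b).
have lx : linear fx := lr x; have ly : linear fy := lr y.
have [lsx lsy] := (psubst_linear lx lam_linear, psubst_linear ly lam_linear).
have lZ : linear (fun b => k *: fx b) by apply: linear_prop_scale.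
rewrite /extend2 -psubstZ ?mu_linear //; last exact: mu_linear.
rewrite -psubstD //; [|exact: linear_prop_scale|exact: mu_linear].
apply: eq_psubst => n; rewrite -psubstZ //; last exact: lam_linear.
rewrite -psubstD //; last exact: lam_linear.
by apply: eq_psubst => m; apply: ll.
Qed.

Lemma lprod_constl op S a v : conformal_superalgebra op -> linear S ->
  lprod op S (C a) v = extend2 (fun b => psubst C S (op a b)) v.
Proof.
by move=> cop lS; rewrite /lprod extend2_const2 //; apply: extend2_linear_fun.
Qed.

Lemma lprod_const2 op S a b : conformal_superalgebra op -> linear S ->
  lprod op S (C a) (C b) = psubst C S (op a b).
Proof.
move=> cop lS; rewrite lprod_constl // extend2_const2 //.
exact: prodl_linear.
Qed.

Lemma extend2_psubst (f : A -> poly2 A) S p : linear f ->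
    linear S -> (forall u, extend2 f (S u) = S (extend2 f u)) ->
  extend2 f (psubst C S p) = psubst f S p.
Proof.
move=> lf lS fS; have le := extend2_linear lf.
rewrite (psubst_intertwine p const2_linear lS le lS) //.
by apply: eq_psubst => n; rewrite extend2_const2.
Qed.

(** The last hypothesis holds for lambda and mu, but can fail when [Q] involves partial, since [f]
    need not commute with it. Parameters with partial are therefore reached only afterwards, through
    [subst2]. *)
Lemma lprod_rtriple op1 op2 P Q a b c :
    conformal_superalgebra op1 -> conformal_superalgebra op2 ->
    linear P -> linear Q ->
    (forall f u, linear f -> extend2 f (Q u) = Q (extend2 f u)) ->
  lprod op1 P (C a) (lprod op2 Q (C b) (C c)) = rtriple op1 op2 P Q a b c.
Proof.
move=> c1 c2 lP lQ eQ; have lf := prodl_linear a c1 lP.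
by rewrite lprod_constl // lprod_const2 // extend2_psubst // => u; apply: eQ.
Qed.

Lemma lprod_ltriple op1 op2 P Q a b c :
    conformal_superalgebra op1 -> conformal_superalgebra op2 ->
    linear P -> linear Q ->
    (forall f u, linear f -> extend2 f (P u) = P (extend2 f u)) ->
  lprod op2 (addop P Q) (lprod op1 P (C a) (C b)) (C c)
    = ltriple op1 op2 P Q a b c.
Proof.
move=> c1 c2 lP lQ eP.
have lPQ : linear (addop P Q) by apply: linear_prop_add.
have lf := extend2_linear_fun (C c) c2 lPQ.
rewrite lprod_const2 // {1}/lprod extend2_psubst // => [|u]; last exact: eP.
apply: eq_psubst => n; rewrite extend2_const2 //; exact: prodl_linear.
Qed.

(* The substitution lambda := P, mu := Q in A[lambda, mu]. *)
Definition subst2 P Q : poly2 A -> poly2 A := psubst (psubst C P) Q.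

(** * Substituting parameters in triple products *)

Section Transport.
Variables (P Q : poly2 A -> poly2 A).
Hypothesis PQ : compatible P Q.

Lemma subst2_linear : linear (subst2 P Q).
Proof.
case: PQ => lP lQ _ _ _; apply: psubst_linear lQ.
exact: psubst_linear const2_linear lP.
Qed.

Lemma subst2_const2 a : subst2 P Q (C a) = C a.
Proof.
case: PQ => lP lQ _ _ _; have lC := const2_linear.
have lS := psubst_linear lC lP.
rewrite -[RHS](psubst_const a (linear_prop0 lC) (linear_prop0 lP)).
exact: psubst_const (linear_prop0 lS) (linear_prop0 lQ).
Qed.

Lemma subst2_mu u : subst2 P Q (M u) = Q (subst2 P Q u).
Proof.
case: PQ => lP lQ _ _ _; have lS := psubst_linear const2_linear lP.
exact: psubst_mulX.
Qed.

(** [P] crosses the outer evaluation at [Q] because the two commute. *)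
Lemma subst2_lam u : subst2 P Q (L u) = P (subst2 P Q u).
Proof.
case: PQ => lP lQ cPQ _ _; have lS := psubst_linear const2_linear lP.
rewrite /subst2 [RHS](psubst_intertwine _ lS lQ lP lQ) //.
by apply: eq_fsbigr => n _ /=; rewrite psubst_mulX //; exact: const2_linear.
Qed.

Lemma subst2_psubst S S' p : linear S -> linear S' ->
    (forall u, subst2 P Q (S u) = S' (subst2 P Q u)) ->
  subst2 P Q (psubst C S p) = psubst C S' p.
Proof.
move=> lS lS' SS'.
rewrite (psubst_intertwine p const2_linear lS subst2_linear lS') //.
by apply: eq_psubst => n; apply: subst2_const2.
Qed.

(** The substitution intertwines [T] with [T'] in the outer evaluation and [S] with [S'] in the
    inner one. With [subst2_ltriple], this carries axioms stated for lambda and mu to any compatible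
    pair. *)
Lemma subst2_rtriple op1 op2 (S T S' T' : poly2 A -> poly2 A) a b c :
    conformal_superalgebra op1 -> linear S -> linear T -> linear S' -> linear T' ->
    (forall u, subst2 P Q (S u) = S' (subst2 P Q u)) ->
    (forall u, subst2 P Q (T u) = T' (subst2 P Q u)) ->
  subst2 P Q (rtriple op1 op2 S T a b c) = rtriple op1 op2 S' T' a b c.
Proof.
move=> c1 lS lT lS' lT' SS TT; have li := prodl_linear a c1 lS.
rewrite /rtriple (psubst_intertwine _ li lT subst2_linear lT') //.
by apply: eq_psubst => n; apply: subst2_psubst.
Qed.

Lemma subst2_ltriple op1 op2 (S T S' T' : poly2 A -> poly2 A) a b c :
    conformal_superalgebra op2 -> linear S -> linear T -> linear S' -> linear T' ->
    (forall u, subst2 P Q (S u) = S' (subst2 P Q u)) ->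
    (forall u, subst2 P Q (T u) = T' (subst2 P Q u)) ->
  subst2 P Q (ltriple op1 op2 S T a b c) = ltriple op1 op2 S' T' a b c.
Proof.
move=> c2 lS lT lS' lT' SS TT.
have lST : linear (addop S T) by apply: linear_prop_add.
have lST' : linear (addop S' T') by apply: linear_prop_add.
have li := prodr_linear c c2 lST.
rewrite /ltriple (psubst_intertwine _ li lS subst2_linear lS') //.
apply: eq_psubst => n; apply: subst2_psubst => // u.
by rewrite (linear_propD _ _ subst2_linear) SS TT.
Qed.

End Transport.

(** * The substitution -partial-lambda inside triple products *)

Section Flips.
Variables (op1 op2 : lambda_product A) (P Q : poly2 A -> poly2 A).
Hypotheses (c1 : conformal_superalgebra op1) (c2 : conformal_superalgebra op2).
Hypothesis PQ : compatible P Q.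

Lemma psubst_flip1_const2 S p : linear S -> (forall u, D (S u) = S (D u)) ->
  psubst C S (flip1 p) = psubst C (fun u => - D u - S u) p.
Proof.
move=> lS DS; apply: psubst_flip1 DS => //.
- exact: const2_linear.
- exact: partial2_linear.
- by move=> a; rewrite partial2_const2.
Qed.

Lemma prodl_partial S a x : linear S -> (forall u, D (S u) = S (D u)) ->
  psubst C S (op1 a (partial A x)) = addop D S (psubst C S (op1 a x)).
Proof.
move=> lS DS; rewrite (conf_sesqui_r c1).
rewrite (linear_propD _ _ (psubst_linear const2_linear lS)).
rewrite (psubst_partial1 (E := D)) //.
- by rewrite psubst_mulX //; exact: const2_linear.
- exact: const2_linear.
- exact: partial2_linear.
- by move=> b; rewrite partial2_const2.
Qed.

Lemma prodr_partial S x c : linear S ->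
  psubst C S (op2 (partial A x) c) = - S (psubst C S (op2 x c)).
Proof.
move=> lS; rewrite (conf_sesqui_l c2).
rewrite (linear_propN _ (psubst_linear const2_linear lS)).
by rewrite psubst_mulX //; exact: const2_linear.
Qed.

(** By sesquilinearity, partial on the right factor of a product with parameter [P] acts on the
    result as D + P; so -partial-Q becomes -(D + P) - Q. *)
Lemma rtriple_flip_inner a b c :
  psubst (fun x => psubst C P (op1 a x)) Q (flip1 (op2 b c))
    = rtriple op1 op2 P (third P Q) a b c.
Proof.
case: PQ => lP lQ cPQ DP DQ.
rewrite (psubst_flip1 (E := addop D P)) //.
- congr (psubst _ _ _); apply/funext => u.
  by rewrite /third /addop opprD opprD !addrA.
- exact: prodl_linear.
- exact: linear_prop_add partial2_linear lP.
- by move=> x; apply: prodl_partial.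
- by move=> u; rewrite /addop DQ cPQ (linear_propD _ _ lQ).
Qed.

(** Partial on the left factor of a product with parameter P + Q acts as -(P + Q); so -partial-P
    becomes (P + Q) - P = Q. *)
Lemma ltriple_flip_inner a b c :
  psubst (fun x => psubst C (addop P Q) (op2 x c)) P (flip1 (op1 b a))
    = ltriple op1 op2 Q P b a c.
Proof.
case: (PQ) => lP lQ cPQ DP DQ; have lPQ := addop_linear PQ.
rewrite (psubst_flip1 (E := fun u => - addop P Q u)) //.
- rewrite addopC; congr (psubst _ _ _); apply/funext => u.
  by rewrite opprK addrK.
- exact: prodr_linear.
- exact: linear_prop_opp.
- by move=> x; rewrite prodr_partial.
- by move=> u; rewrite /addop (linear_propN _ lP) (linear_propD _ _ lP) cPQ.
Qed.

(** The outer partial already acts on the result: -D - P is the sum of [Q] and [third P Q], the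
    parameters of [b] and [c]. *)
Lemma rtriple_flip_outer a b c :
  psubst (fun x => psubst C P (flip1 (op2 x a))) Q (op1 b c)
    = ltriple op1 op2 Q (third P Q) b c a.
Proof.
case: PQ => lP lQ cPQ DP DQ; apply: eq_psubst => n.
rewrite psubst_flip1_const2 //; congr (psubst _ _ _); apply/funext => u.
by rewrite /addop /third opprD addrCA (addrC (- P u)) addNKr.
Qed.

(** Here -D - (P + Q) is [third P Q] by definition, the parameter of [c]. *)
Lemma ltriple_flip_outer a b c :
  psubst (fun x => psubst C (addop P Q) (flip1 (op1 c x))) P (op2 a b)
    = rtriple op1 op2 (third P Q) P c a b.
Proof.
case: (PQ) => lP lQ cPQ DP DQ; apply: eq_psubst => n.
rewrite psubst_flip1_const2 //; first exact: addop_linear.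
by move=> u; rewrite /addop (linear_propD _ _ partial2_linear) DP DQ.
Qed.

End Flips.

End TripleProducts.

(** * The super commutator *)

Section HomogeneousComponents.
Context (K : fieldType) (A : gradedDModule K).
Implicit Types (a b : A) (i : bool).

Lemma hom_compP i a : hom_comp i a \in hom_part A i.
Proof.
by rewrite /hom_comp; case: i; case/and3P: (xchooseP (hom_decomp a)).
Qed.

Lemma hom_comp_sum a : a = hom_comp false a + hom_comp true a.
Proof.
by rewrite /hom_comp; case/and3P: (xchooseP (hom_decomp a)) => _ _ /eqP.
Qed.

(** The components come from a choice, so uniqueness is needed. For two decompositions, the
    difference of the even parts equals an odd element, hence vanishes. *)
Lemma hom_comp_unique (u : bool -> A) : (forall i, u i \in hom_part A i) ->
  forall i, hom_comp i (u false + u true) = u i.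
Proof.
move=> hu; set a := _ + _.
have inB i x y : x \in hom_part A i -> y \in hom_part A i -> x - y \in hom_part A i.
  by move=> hx hy; rewrite -scaleN1r; apply: rpredD => //; apply: rpredZ.
have E : hom_comp false a - u false = u true - hom_comp true a.
  by apply/eqP; rewrite subr_eq addrAC eq_sym subr_eq -hom_comp_sum addrC.
have e0 : hom_comp false a = u false.
  apply/eqP; rewrite -subr_eq0; apply/eqP/hom_disjoint.
    by apply: inB => //; apply: hom_compP.
  by rewrite E; apply: inB => //; apply: hom_compP.
case=> //; apply/esym/eqP; rewrite -subr_eq0 -E e0 subrr //.
Qed.

Lemma hom_comp_hom i j a : a \in hom_part A i ->
  hom_comp j a = if i == j then a else 0.
Proof.
move=> ha; rewrite -(@hom_comp_unique (fun j => if i == j then a else 0)).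
  by case: i {ha} => /=; rewrite ?add0r ?addr0.
by move=> k; case: eqP => [<-//|_]; apply: rpred0.
Qed.

Lemma hom_comp_linear i : linear (@hom_comp K A i).
Proof.
move=> k a b.
rewrite -(@hom_comp_unique (fun i => k *: hom_comp i a + hom_comp i b)).
  by rewrite addrACA -scalerDr -!hom_comp_sum.
by move=> j; apply: rpredD; [apply: rpredZ|]; apply: hom_compP.
Qed.

(** Signs make sense only for homogeneous arguments; this extends signed computations to arguments
    not assumed homogeneous. *)
Lemma eq_linear_hom (V : lmodType K) (f g : A -> V) : linear f -> linear g ->
    (forall i a, a \in hom_part A i -> f a = g a) -> f =1 g.
Proof.
move=> lf lg fg a; rewrite [a]hom_comp_sum (linear_propD _ _ lf).
by rewrite (linear_propD _ _ lg) !(fg _ _ (hom_compP _ _)).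
Qed.

End HomogeneousComponents.

Section Signs.
Context (K : fieldType).

Lemma ksignC i j : ksign K i j = ksign K j i.
Proof. by rewrite /ksign andbC. Qed.

Lemma ksignDr i j k : ksign K i (j (+) k) = ksign K i j * ksign K i k.
Proof. by rewrite /ksign -signr_addb andb_addr. Qed.

Lemma ksign_sq i j : ksign K i j * ksign K i j = 1.
Proof. by rewrite /ksign -signr_addb addbb. Qed.

End Signs.

Section Commutator.
Context (K : fieldType) (A : gradedDModule K) (ast : lambda_product A).
Hypothesis cast : conformal_superalgebra ast.
Local Notation br := (super_commutator ast).

Let ast0r a : ast a 0 = 0.
Proof. exact: linear_prop0 (conf_linear_r cast a). Qed.

Let ast0l a : ast 0 a = 0.
Proof. exact: linear_prop0 (conf_linear_l cast a). Qed.

Let flip0 : @flip1 K A 0 = 0.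
Proof. exact: linear_prop0 (@flip1_linear K A). Qed.

(** All components of [a] and [b] but one vanish, so a single term of the double sum survives. *)
Lemma super_commutator_hom i j a b : a \in hom_part A i -> b \in hom_part A j ->
  br a b = ast a b - ksign K i j *: flip1 (ast b a).
Proof.
move=> ha hb; rewrite /super_commutator (bigD1 i) //= (bigD1 j) //=.
rewrite !(hom_comp_hom _ ha) !(hom_comp_hom _ hb) !eqxx.
rewrite !big1 ?addr0 // => [k /negPf ki|k /negPf kj].
  rewrite big1 // => l _; rewrite (hom_comp_hom _ ha) eq_sym ki.
  by rewrite ast0l ast0r flip0 scaler0 subr0.
rewrite (hom_comp_hom _ hb) (eq_sym j) kj.
by rewrite ast0l ast0r flip0 scaler0 subr0.
Qed.

Lemma super_commutator_linear_l b : linear (br ^~ b).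
Proof.
move=> k x y; rewrite /super_commutator scaler_sumr -big_split /=.
apply: eq_bigr => i _; rewrite scaler_sumr -big_split /=.
apply: eq_bigr => j _; rewrite hom_comp_linear (conf_linear_l cast).
rewrite (conf_linear_r cast) flip1_linear; set s := ksign _ _ _.
rewrite scalerBr scalerDr !scalerA (mulrC s) opprD addrACA //.
Qed.

Lemma super_commutator_linear_r a : linear (br a).
Proof.
move=> k x y; rewrite /super_commutator scaler_sumr -big_split /=.
apply: eq_bigr => i _; rewrite scaler_sumr -big_split /=.
apply: eq_bigr => j _; rewrite hom_comp_linear (conf_linear_l cast).
rewrite (conf_linear_r cast) flip1_linear; set s := ksign _ _ _.
rewrite scalerBr scalerDr !scalerA (mulrC s) opprD addrACA //.
Qed.

Lemma super_commutator_conformal : conformal_superalgebra br.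
Proof.
split.
- exact: super_commutator_linear_l.
- exact: super_commutator_linear_r.
- move=> i j a b ha hb n; rewrite (super_commutator_hom ha hb).
  have hba : forall n, ast b a n \in hom_part A (i (+) j).
    by move=> m; rewrite addbC; apply: conf_graded.
  change (ast a b n - ksign K i j *: flip1 (ast b a) n \in hom_part A (i (+) j)).
  rewrite -scaleNr; apply: rpredD; first exact: conf_graded.
  by apply: rpredZ; apply: flip1_hom.
- move=> a b; move: b a.
  have ll := super_commutator_linear_l; have lr := super_commutator_linear_r.
  have lN : linear (fun p => - @lam1 K A p).
    by apply: linear_prop_opp; apply: lam1_linear.
  have ld : linear (partial A) := linearP _.
  move=> b; apply: eq_linear_hom => [||i a ha].
  - exact: linear_prop_comp ld (ll b).
  - exact: linear_prop_comp (ll b) lN.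
  move: b; apply: eq_linear_hom => [||j b hb].
  - exact: lr.
  - exact: linear_prop_comp (lr a) lN.
  rewrite (super_commutator_hom (hom_partial ha) hb) (super_commutator_hom ha hb).
  rewrite (conf_sesqui_l cast) (conf_sesqui_r cast).
  (* The flip sends partial + lambda to partial + (-partial-lambda) = -lambda. *)
  rewrite (linear_propD _ _ (@flip1_linear K A)) flip1_partial1 flip1_lam1.
  rewrite addrA subrr add0r (linear_propB _ _ (@lam1_linear K A)).
  by rewrite (linear_propZ _ _ (@lam1_linear K A)) scalerN opprD.
- move=> a; have lr := super_commutator_linear_r.
  have ll := super_commutator_linear_l.
  have lN : linear (fun p => partial1 p + @lam1 K A p).
    by apply: linear_prop_add; [apply: partial1_linear|apply: lam1_linear].
  have ld : linear (partial A) := linearP _.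
  apply: eq_linear_hom => [||j b hb].
  - exact: linear_prop_comp ld (lr a).
  - exact: linear_prop_comp (lr a) lN.
  move: a; apply: eq_linear_hom => [||i a ha].
  - exact: ll.
  - exact: linear_prop_comp (ll b) lN.
  rewrite (super_commutator_hom ha (hom_partial hb)) (super_commutator_hom ha hb).
  rewrite (conf_sesqui_l cast) (conf_sesqui_r cast).
  (* Conversely, the flip sends -lambda to partial + lambda. *)
  rewrite (linear_propN _ (@flip1_linear K A)) flip1_lam1 opprB opprK.
  rewrite (linear_propB _ _ (@lam1_linear K A)).
  rewrite (linear_propB _ _ (@partial1_linear K A)).
  rewrite (linear_propZ _ _ (@lam1_linear K A)).
  rewrite (linear_propZ _ _ (@partial1_linear K A)).
  by rewrite (addrC (lam1 _)) scalerDr opprD addrACA.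
Qed.

Lemma super_commutator_skew i j a b : a \in hom_part A i -> b \in hom_part A j ->
  br a b = - (ksign K i j *: flip1 (br b a)).
Proof.
move=> ha hb; rewrite (super_commutator_hom ha hb) (super_commutator_hom hb ha).
rewrite (linear_propB _ _ (@flip1_linear K A)) (linear_propZ _ _ (@flip1_linear K A)).
by rewrite flip1K scalerBr scalerA (ksignC K j) ksign_sq scale1r opprB.
Qed.

End Commutator.

(** * Triple products involving the commutator *)

Section TripleProductLinearity.
Context (K : fieldType) (A : gradedDModule K).
Variables (op1 op2 : lambda_product A) (P Q : poly2 A -> poly2 A).
Hypotheses (c1 : conformal_superalgebra op1) (c2 : conformal_superalgebra op2).
Hypothesis PQ : compatible P Q.

Lemma rtriple_linear a b : linear (rtriple op1 op2 P Q a b).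
Proof.
case: PQ => lP lQ _ _ _.
apply: linear_prop_comp (psubst_linear (prodl_linear a c1 lP) lQ).
exact: conf_linear_r.
Qed.

Lemma ltriple_linear a b : linear (ltriple op1 op2 P Q a b).
Proof.
move=> k x y; have lPQ := addop_linear PQ; case: PQ => lP lQ _ _ _.
have li z := prodr_linear z c2 lPQ; have lx := li x; have ly := li y.
rewrite /ltriple -psubstZ // -psubstD //; last exact: linear_prop_scale.
by apply: eq_psubst => n; apply: prodl_linear.
Qed.

End TripleProductLinearity.

Section CommutatorProducts.
Context (K : fieldType) (A : gradedDModule K).
Variables (ast op : lambda_product A) (P Q : poly2 A -> poly2 A).
Hypotheses (cast : conformal_superalgebra ast) (cop : conformal_superalgebra op).
Hypothesis PQ : compatible P Q.
Variables (i j k : bool) (a b c : A).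
Hypotheses (ha : a \in hom_part A i) (hb : b \in hom_part A j)
  (hc : c \in hom_part A k).
Local Notation br := (super_commutator ast).
Local Notation s := (ksign K).

Lemma psubst_sub_scale (M V : lmodType K) (f : M -> V) (S : V -> V) e
    (p q : polymod M) : linear f -> linear S ->
  psubst f S (p - e *: q) = psubst f S p - e *: psubst f S q.
Proof.
move=> lf lS; have lp := psubst_linear lf lS.
by rewrite (linear_propB _ _ lp) (linear_propZ _ _ lp).
Qed.

Lemma psubst_fun_sub_scale (M V : lmodType K) (f g : M -> V) (S : V -> V) e
    (p : polymod M) : linear f -> linear g -> linear S ->
  psubst (fun x => f x - e *: g x) S p = psubst f S p - e *: psubst g S p.
Proof.
move=> lf lg lS; have lN : linear (fun x => - e *: g x).
  exact: linear_prop_scale.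
rewrite -scaleNr -psubstZ // -psubstD //.
by apply: eq_psubst => n; rewrite scaleNr.
Qed.

Lemma rtriple_commutator_inner :
  rtriple op br P Q a b c =
    rtriple op ast P Q a b c - s j k *: rtriple op ast P (third P Q) a c b.
Proof.
case: (PQ) => lP lQ _ _ _; have lf := prodl_linear a cop lP.
by rewrite {1}/rtriple (super_commutator_hom cast hb hc) psubst_sub_scale //
  (rtriple_flip_inner ast cop PQ).
Qed.

Lemma ltriple_commutator_inner :
  ltriple br op P Q a b c =
    ltriple ast op P Q a b c - s i j *: ltriple ast op Q P b a c.
Proof.
case: (PQ) => lP lQ _ _ _; have lf := prodr_linear c cop (addop_linear PQ).
by rewrite {1}/ltriple (super_commutator_hom cast ha hb) psubst_sub_scale //
  (ltriple_flip_inner ast cop PQ).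
Qed.

(** Each coefficient of the inner product has parity |b| + |c|, so the commutator formula applies
    coefficientwise, with a sign that factors over the pairs (a, b) and (a, c). *)
Lemma rtriple_commutator_outer :
  rtriple br op P Q a b c =
    rtriple ast op P Q a b c
      - (s i j * s i k) *: ltriple op ast Q (third P Q) b c a.
Proof.
case: (PQ) => lP lQ _ _ _; have lf := prodl_linear a cast lP.
have lC := psubst_linear (@const2_linear K A) lP.
have lg : linear (fun x => psubst (@const2 K A) P (flip1 (ast x a))).
  apply: linear_prop_comp lC.
  apply: (linear_prop_comp (f := ast ^~ a)); last exact: flip1_linear.
  exact: conf_linear_l.
rewrite -(rtriple_flip_outer op ast PQ) -psubst_fun_sub_scale //.
apply: eq_psubst => n.
rewrite (super_commutator_hom cast ha (conf_graded cop hb hc n)) ksignDr.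
by rewrite (linear_propB _ _ lC) (linear_propZ _ _ lC).
Qed.

Lemma ltriple_commutator_outer :
  ltriple op br P Q a b c =
    ltriple op ast P Q a b c
      - (s i k * s j k) *: rtriple ast op (third P Q) P c a b.
Proof.
case: (PQ) => lP lQ _ _ _; have lPQ := addop_linear PQ.
have lf := prodr_linear c cast lPQ.
have lC := psubst_linear (@const2_linear K A) lPQ.
have lg : linear (fun x => psubst (@const2 K A) (addop P Q) (flip1 (ast c x))).
  apply: linear_prop_comp lC.
  apply: linear_prop_comp (@flip1_linear K A); exact: conf_linear_r.
rewrite -(ltriple_flip_outer ast op PQ) -psubst_fun_sub_scale //.
apply: eq_psubst => n.
rewrite (super_commutator_hom cast (conf_graded cop ha hb n) hc).
rewrite ksignC ksignDr !(ksignC K k).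
by rewrite (linear_propB _ _ lC) (linear_propZ _ _ lC).
Qed.

End CommutatorProducts.

(** * Triple products with a commutative factor *)

Section CommutativeProducts.
Context (K : fieldType) (A : gradedDModule K).
Variables (circ op : lambda_product A) (P Q : poly2 A -> poly2 A).
Hypotheses (ccirc : conformal_superalgebra circ) (cop : conformal_superalgebra op).
Hypothesis circC : commutative_product circ.
Hypothesis PQ : compatible P Q.
Variables (i j k : bool) (a b c : A).
Hypotheses (ha : a \in hom_part A i) (hb : b \in hom_part A j)
  (hc : c \in hom_part A k).
Local Notation s := (ksign K).

Lemma rtriple_commutative_inner :
  rtriple op circ P Q a b c = s j k *: rtriple op circ P (third P Q) a c b.
Proof.
case: (PQ) => lP lQ _ _ _; have lf := psubst_linear (prodl_linear a cop lP) lQ.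
by rewrite {1}/rtriple (circC hb hc) (linear_propZ _ _ lf)
  (rtriple_flip_inner circ cop PQ).
Qed.

Lemma rtriple_commutative_outer :
  rtriple circ op P Q a b c =
    (s i j * s i k) *: ltriple op circ Q (third P Q) b c a.
Proof.
case: (PQ) => lP lQ _ _ _.
have lC := psubst_linear (@const2_linear K A) lP.
have lg : linear (fun x => psubst (@const2 K A) P (flip1 (circ x a))).
  apply: linear_prop_comp lC.
  apply: (linear_prop_comp (f := circ ^~ a)); last exact: flip1_linear.
  exact: conf_linear_l.
rewrite -(rtriple_flip_outer op circ PQ) -psubstZ //.
apply: eq_psubst => n.
by rewrite (circC ha (conf_graded cop hb hc n)) ksignDr (linear_propZ _ _ lC).
Qed.

End CommutativeProducts.

(** * Cancellation of signed terms *)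

Section ModuleIdentities.
Context (K : fieldType) (V : lmodType K).
Implicit Types (x y z : V) (s : K).

(** Regroups left-symmetry so that a signed difference of left-nested products becomes one of
    right-nested products. *)
Lemma sub_scale_swap x y z w s : x - y = s *: (z - w) -> x - s *: z = y - s *: w.
Proof.
by move=> /eqP; rewrite subr_eq => /eqP ->; rewrite scalerBr addrC !addrA addNr add0r addrC.
Qed.

(** Here x, y stand for a(bc), a(cb); v, z for b(ac), b(ca); w, u for c(ab), c(ba); and s, t, r for
    the signs of (a, b), (a, c), (b, c). *)
Lemma jacobi_identity x y z u v w s t r : s * s = 1 ->
  (x - r *: y) - (s * t) *: (z - r *: u) =
  (x - s *: v) - (t * r) *: (w - s *: u)
    + s *: ((v - t *: z) - (s * r) *: (y - t *: w)).
Proof.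
move=> ss; rewrite !scalerBr !scalerA !mulrA ss !mul1r.
rewrite (mulrC (t * r)) (mulrC r) !mulrA [RHS]addrACA !opprB.
rewrite (addrA (x - s *: v)) subrK (addrA (_ - (t * r) *: w)) subrK.
by rewrite addrACA [RHS]addrACA (addrC (- (r *: y))).
Qed.

(** With the same signs, u, v stand for the [circ] products of bc, cb with a, and x, w for b(ac),
    c(ab). One copy of the left side is already on the right; the second is the hypothesis
    multiplied by st. *)
Lemma transposed_identity u v x w s t r : s * s = 1 -> t * t = 1 ->
    u - t *: x = r *: (v - s *: w) ->
  2%:R *: ((s * t) *: u - r *: ((t * s) *: v)) =
  ((s * t) *: u - (t * r) *: w) + s *: (x - (s * r) *: ((t * s) *: v)).
Proof.
move=> ss tt /sub_scale_swap/(congr1 ( *:%R (s * t))).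
have e1 : s * t * r = r * (t * s) by rewrite mulrC (mulrC s).
have e2 : s * t * (r * s) = t * r.
  by rewrite (mulrC s) -mulrA (mulrCA s) ss mulr1.
have e3 : s * (s * r) * (t * s) = r * (t * s) by rewrite !mulrA ss mul1r.
rewrite !(scalerBr (_ * _)) (scalerBr s) !scalerA e1 e2 e3 -(mulrA s t t) tt mulr1.
by move=> E; rewrite addrACA (addrC (- _)) addrACA -E scaler_nat mulr2n.
Qed.

End ModuleIdentities.

(** * Novikov-Poisson conformal superalgebras *)

Section NovikovPoisson.
Context (K : fieldType) (A : gradedDModule K) (circ ast : lambda_product A).
Hypothesis np : Novikov_Poisson_conformal circ ast.
Local Notation br := (super_commutator ast).
Local Notation s := (ksign K).
Local Notation L := (@lam K A).
Local Notation M := (@mu K A).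

Let ccirc : conformal_superalgebra circ := ca_conformal (np_circ np).
Let cast : conformal_superalgebra ast :=
  ls_conformal (nov_left_symmetric (np_ast np)).
Let cbr : conformal_superalgebra br := super_commutator_conformal cast.

(** The bridge between the products of the axioms, with parameters lambda and mu in either order,
    and the triple products used for computation. *)
Let lprodE op1 op2 (c1 : conformal_superalgebra op1)
    (c2 : conformal_superalgebra op2) (a b c : A) :
  [/\ lprod op1 L (const2 a) (lprod op2 M (const2 b) (const2 c))
        = rtriple op1 op2 L M a b c,
      lprod op1 M (const2 a) (lprod op2 L (const2 b) (const2 c))
        = rtriple op1 op2 M L a b c,
      lprod op2 (@lam_add_mu K A) (lprod op1 L (const2 a) (const2 b)) (const2 c)
        = ltriple op1 op2 L M a b c
    & lprod op2 (@lam_add_mu K A) (lprod op1 M (const2 a) (const2 b)) (const2 c)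
        = ltriple op1 op2 M L a b c].
Proof.
have [lL lM] := (@lam_linear K A, @mu_linear K A).
have eL f u : linear f -> extend2 f (L u) = L (extend2 f u) := @extend2_lam K A f u.
have eM f u : linear f -> extend2 f (M u) = M (extend2 f u) := @extend2_mu K A f u.
have addLM : @lam_add_mu K A = addop M L by apply: addopC.
split.
- exact (lprod_rtriple a b c c1 c2 lL lM eM).
- exact (lprod_rtriple a b c c1 c2 lM lL eL).
- exact (lprod_ltriple a b c c1 c2 lL lM eL).
- rewrite addLM; exact (lprod_ltriple a b c c1 c2 lM lL eM).
Qed.

Lemma subst2_triples op1 op2 P Q (a b c : A) :
    conformal_superalgebra op1 -> conformal_superalgebra op2 -> compatible P Q ->
  [/\ subst2 P Q (rtriple op1 op2 L M a b c) = rtriple op1 op2 P Q a b c,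
      subst2 P Q (rtriple op1 op2 M L a b c) = rtriple op1 op2 Q P a b c,
      subst2 P Q (ltriple op1 op2 L M a b c) = ltriple op1 op2 P Q a b c
    & subst2 P Q (ltriple op1 op2 M L a b c) = ltriple op1 op2 Q P a b c].
Proof.
move=> c1 c2 PQ; have [lL lM] := (@lam_linear K A, @mu_linear K A).
have [sL sM] := (subst2_lam PQ, subst2_mu PQ); case: (PQ) => lP lQ _ _ _.
split.
- exact (subst2_rtriple PQ op2 a b c c1 lL lM lP lQ sL sM).
- exact (subst2_rtriple PQ op2 a b c c1 lM lL lQ lP sM sL).
- exact (subst2_ltriple PQ op1 a b c c2 lL lM lP lQ sL sM).
- exact (subst2_ltriple PQ op1 a b c c2 lM lL lQ lP sM sL).
Qed.

(** Obtained by applying [subst2 P Q] to the axiom. Four products are allowed so that it covers both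
    left-symmetry of [ast] and the axiom mixing [ast] and [circ]. *)
Lemma triple_left_symmetric op1 op2 op3 op4 P Q (e : K) a b c :
    conformal_superalgebra op1 -> conformal_superalgebra op2 ->
    conformal_superalgebra op3 -> conformal_superalgebra op4 ->
    compatible P Q ->
    lprod op2 (@lam_add_mu K A) (lprod op1 L (const2 a) (const2 b)) (const2 c)
      - lprod op3 L (const2 a) (lprod op4 M (const2 b) (const2 c)) =
    e *: (lprod op2 (@lam_add_mu K A) (lprod op1 M (const2 b) (const2 a)) (const2 c)
         - lprod op3 M (const2 b) (lprod op4 L (const2 a) (const2 c))) ->
  ltriple op1 op2 P Q a b c - rtriple op3 op4 P Q a b c =
    e *: (ltriple op1 op2 Q P b a c - rtriple op3 op4 Q P b a c).
Proof.
move=> c1 c2 c3 c4 PQ; have lS := subst2_linear PQ.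
have [_ _ -> _] := lprodE c1 c2 a b c; have [-> _ _ _] := lprodE c3 c4 a b c.
have [_ _ _ ->] := lprodE c1 c2 b a c; have [_ -> _ _] := lprodE c3 c4 b a c.
move=> /(congr1 (subst2 P Q)); rewrite (linear_propZ _ _ lS) !(linear_propB _ _ lS).
have [_ _ -> _] := subst2_triples a b c c1 c2 PQ.
have [-> _ _ _] := subst2_triples a b c c3 c4 PQ.
have [_ _ _ ->] := subst2_triples b a c c1 c2 PQ.
by have [_ -> _ _] := subst2_triples b a c c3 c4 PQ.
Qed.

Lemma triple_circ_ast P Q a b c : compatible P Q ->
  ltriple circ ast P Q a b c = rtriple circ ast P Q a b c.
Proof.
move=> PQ; have /(congr1 (subst2 P Q)) := np_circ_ast np a b c.
have [-> _ -> _] := lprodE ccirc cast a b c.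
by have [-> _ -> _] := subst2_triples a b c ccirc cast PQ.
Qed.

Lemma triple_ast_left_symmetric P Q i j a b c : compatible P Q ->
    a \in hom_part A i -> b \in hom_part A j ->
  ltriple ast ast P Q a b c - s i j *: ltriple ast ast Q P b a c =
    rtriple ast ast P Q a b c - s i j *: rtriple ast ast Q P b a c.
Proof.
move=> PQ ha hb; apply/sub_scale_swap/triple_left_symmetric => //.
exact: ls_left_symmetric (nov_left_symmetric (np_ast np)) _ _ _ _ _ ha hb.
Qed.

(** The parameters lambda, mu and N = -partial-lambda-mu: any two are compatible, and [third] of any
    two is the remaining one. *)
Let LM := compatible_lam_mu A.
Let ML := compatibleC LM.
Let N := third L M.
Let MN : compatible M N := compatible_third LM.
Let NM : compatible N M := compatibleC MN.
Let NL : compatible N L := eq_ind _ (compatible N) (compatible_third MN) _ (thirdK L M).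
Let LN : compatible L N := compatibleC NL.

Let thirdML : third M L = N. Proof. by rewrite thirdC. Qed.
Let thirdMN : third M N = L. Proof. exact: thirdK. Qed.
Let thirdNM : third N M = L. Proof. by rewrite thirdC. Qed.
Let thirdNL : third N L = M. Proof. by rewrite thirdC -thirdML thirdK. Qed.
Let thirdLN : third L N = M. Proof. by rewrite thirdC. Qed.

Lemma super_commutator_Jacobi i j a b c :
    a \in hom_part A i -> b \in hom_part A j ->
  rtriple br br L M a b c =
    ltriple br br L M a b c + s i j *: rtriple br br M L b a c.
Proof.
(* Both sides are linear in [c], so [c] may be taken homogeneous and given a sign. *)
move=> ha hb; move: c; apply: eq_linear_hom => [||k c hc].
- exact: rtriple_linear cbr cbr LM a b.
- apply: linear_prop_add (ltriple_linear br cbr LM a b) _.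
  exact: linear_prop_scale (rtriple_linear cbr cbr ML b a).
rewrite (rtriple_commutator_outer cast cbr LM ha hb hc).
rewrite (rtriple_commutator_inner cast cast LM a hb hc).
rewrite (ltriple_commutator_inner cast cast MN a hb hc).
rewrite (ltriple_commutator_outer cast cbr LM ha hb hc).
rewrite (ltriple_commutator_inner cast cast LM c ha hb).
rewrite (rtriple_commutator_inner cast cast NL c ha hb).
rewrite (rtriple_commutator_outer cast cbr ML hb ha hc).
rewrite (rtriple_commutator_inner cast cast ML b ha hc) thirdML.
rewrite (ltriple_commutator_inner cast cast LN b ha hc) thirdNL.
(* Left-symmetry for each pair of arguments removes all left-nested products; six right-nested ones
   remain, one per permutation. *)
rewrite (triple_ast_left_symmetric c LM ha hb).
rewrite (triple_ast_left_symmetric b LN ha hc).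
rewrite (triple_ast_left_symmetric a MN hb hc) (ksignC K j i).
exact/jacobi_identity/ksign_sq.
Qed.

Lemma super_commutator_transposed i j a b c :
    a \in hom_part A i -> b \in hom_part A j ->
  2%:R *: rtriple circ br L M a b c =
    ltriple circ br L M a b c + s i j *: rtriple br circ M L b a c.
Proof.
move=> ha hb.
move: c; apply: eq_linear_hom => [||k c hc].
- exact: linear_prop_scale (rtriple_linear ccirc cbr LM a b).
- apply: linear_prop_add (ltriple_linear circ cbr LM a b) _.
  exact: linear_prop_scale (rtriple_linear cbr ccirc ML b a).
have circC := ca_commutative (np_circ np).
rewrite (rtriple_commutator_inner cast ccirc LM a hb hc).
rewrite (ltriple_commutator_outer cast ccirc LM ha hb hc).
rewrite (rtriple_commutator_outer cast ccirc ML hb ha hc) thirdML.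
rewrite !triple_circ_ast //.
(* The mixed axiom is taken for [b], [c] with [a] last. Commutativity then matches it with the goal:
   [E1], [E2] move [a] to the right in the goal's outer products, [E3], [E4] move it to the left in
   the inner products of [H]. *)
have H := triple_left_symmetric cast ccirc cast ccirc MN
  (np_ast_circ np a hb hc).
have E1 := rtriple_commutative_outer ccirc cast circC LM ha hb hc.
have E2 := rtriple_commutative_outer ccirc cast circC LN ha hc hb.
have E3 := rtriple_commutative_inner cast circC MN b hc ha.
have E4 := rtriple_commutative_inner cast circC NM c hb ha.
move: H; rewrite E1 E2 E3 E4 thirdLN thirdMN thirdNM.
rewrite (ksignC K k i) (ksignC K j i); apply: transposed_identity; exact: ksign_sq.
Qed.

Lemma super_commutator_TPCSA : TPCSA circ br.
Proof.
split; first exact: np_circ np.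
- split; first exact: cbr.
  + exact: super_commutator_skew cast.
  + move=> i j a b c ha hb.
    have [-> _ -> _] := lprodE cbr cbr a b c.
    by have [_ -> _ _] := lprodE cbr cbr b a c; apply: super_commutator_Jacobi.
- move=> i j a b c ha hb.
  have [-> _ _ _] := lprodE ccirc cbr a b c.
  have [_ _ -> _] := lprodE ccirc cbr a b c.
  by have [_ -> _ _] := lprodE cbr ccirc b a c; apply: super_commutator_transposed.
Qed.

End NovikovPoisson.

Local Open Scope complex_scope.

Theorem theorem4p4 (R : realType) (N : gradedDModule R[i])
    (circ ast : lambda_product N) :
  Novikov_Poisson_conformal circ ast -> TPCSA circ (super_commutator ast).
Proof. exact: super_commutator_TPCSA. Qed.
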